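(* The derivation of the joint tableau is valid; that is: if $\mathbf{T}_i=(G_i,\mathcal{G}_i,\mathcal{M}_i,\mathcal{X}_i,\simeq^{(i)})$, $i\in\{1,2,\ldots,n\}$, are valid matroid tableaux, then their joint tableau $\bigcup_{i=1}^n\mathbf{T}_i$ is a valid matroid tableau.
   Context: Matroids have finite ground sets. A digraph is a pair $D=(V,A)$ with $V$ finite and $A\subseteq V\times V$. A path in $D$ is a non-empty, non-repeating sequence of vertices $p_1p_2\ldots p_n$ with $(p_i,p_{i+1})\in A$ for $1\le i<n$. A routing from $X$ to $Y$ in $D$ is a family $R$ of paths in $D$ such that every $x\in X$ is the first vertex of some $p\in R$, every $p\in R$ ends in a vertex of $Y$, and any two distinct paths of $R$ are vertex-disjoint. For $E,T\subseteq V$, $\Gamma(D,T,E)$ is the matroid on $E$ whose independent sets are those $X\subseteq E$ for which there is a routing from $X$ to $T$ in $D$. A matroid $(E,\mathcal{I})$ is a gammoid if it equals $\Gamma(D,T,E)$ for some digraph $D=(V,A)$ with $E\subseteq V$ and some $T\subseteq V$; it is a strict gammoid if such a representation exists with $V=E$. A matroid tableau is a tuple $\mathbf{T}=(G,\mathcal{G},\mathcal{M},\mathcal{X},\simeq)$ where $G$ is a matroid (the goal), $\mathcal{G},\mathcal{M},\mathcal{X}$ are families of matroids, and $\simeq$ is an equivalence relation on $\{G'\mid G'\text{ is a minor of }G\}\cup\mathcal{G}\cup\mathcal{M}\cup\mathcal{X}$. $\mathbf{T}$ is valid if (i) all matroids in $\mathcal{G}$ are gammoids, (ii) no matroid in $\mathcal{M}$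 is a strict gammoid, (iii) no matroid in $\mathcal{X}$ is a gammoid, and (iv) every equivalence class of $\simeq$ either consists only of gammoids or contains no gammoid. The joint tableau of $\mathbf{T}_1,\ldots,\mathbf{T}_n$ is $\bigcup_{i=1}^n\mathbf{T}_i=(G_1,\mathcal{G},\mathcal{M},\mathcal{X},\simeq)$ with $\mathcal{G}=\bigcup_i\mathcal{G}_i$, $\mathcal{M}=\bigcup_i\mathcal{M}_i$, $\mathcal{X}=\bigcup_i\mathcal{X}_i$, where $\simeq$ is the equivalence relation generated by $\simeq^{(1)},\ldots,\simeq^{(n)}$ (the smallest equivalence relation, on the union of their underlying families, such that $M\simeq^{(i)}N$ implies $M\simeq N$ for all $i$), restricted to the family $\{G'\mid G'\text{ is a minor of }G_1\}\cup\mathcal{G}\cup\mathcal{M}\cup\mathcal{X}$. *)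

(* Defs.v *)
From HB Require Import structures.
From mathcomp Require Import all_boot finmap.
From mathcomp Require Import boolp classical_sets functions cardinality.

Set Implicit Arguments.
Unset Strict Implicit.
Unset Printing Implicit Defensive.

Local Open Scope fset_scope.
Local Open Scope classical_set_scope.

(* [K] is the universe of ground-set elements and digraph vertices. It must be
   infinite for [gammoid] below to be the usual notion, since a representing
   digraph may need more vertices than there are elements in the matroid. *)

Section Matroid.
Variable K : choiceType.

Record matroid := Matroid {
  ground : {fset K};
  indep : {fset {fset K}};
  indep_sub : forall X, X \in indep -> (X `<=` ground)%fset;
  indep0 : fset0 \in indep;
  indepS : forall X Y, (X `<=` Y)%fset -> Y \in indep -> X \in indep;
  indep_exchange : forall X Y, X \in indep -> Y \in indep -> #|` X| < #|` Y| ->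
    exists2 y, y \in (Y `\` X)%fset & (y |` X)%fset \in indep
}.

Definition basis_of (M : matroid) (Y B : {fset K}) : Prop :=
  [/\ (B `<=` Y)%fset, B \in indep M &
    forall B', (B `<=` B')%fset -> (B' `<=` Y)%fset -> B' \in indep M -> B' = B].

Lemma exists_basis_of M Y : exists B, basis_of M Y B.
Proof.
suff H n B : (#|` (Y `\` B)%fset| <= n)%N -> (B `<=` Y)%fset -> B \in indep M ->
    exists B', basis_of M Y B'.
  by apply: (H _ fset0 (leqnn _)); rewrite ?fsub0set ?indep0.
elim: n B => [|n IHn] B leYB sBY iB; last first.
  have [[y [yY yB iyB]]|nex] :=
    pselect (exists y, [/\ y \in Y, y \notin B & (y |` B)%fset \in indep M]).
    apply: (IHn (y |` B)%fset) => //; last first.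
      by rewrite fsubUset fsub1set yY.
    rewrite -ltnS (leq_trans _ leYB) //; apply: fproper_ltn_card.
    rewrite fproperE; apply/andP; split.
      by apply: fsetDS; apply: fsubsetUr.
    by apply/fsubsetPn; exists y; rewrite !inE ?yY ?yB ?eqxx.
  exists B; split=> // B' sBB' sB'Y iB'; apply/eqP; rewrite eqEfsubset sBB' andbT.
  apply/fsubsetP => y yB'; apply/negPn/negP => yB; case: nex; exists y.
  split=> //; first exact: (fsubsetP sB'Y).
  by apply: indepS iB'; rewrite fsubUset fsub1set yB'.
exists B; split=> // B' sBB' sB'Y iB'; apply/eqP; rewrite eqEfsubset sBB' andbT.
by apply: fsubset_trans sB'Y _; rewrite -fsetD_eq0 -cardfs_eq0 -leqn0.
Qed.

Lemma card_basis_of M Y B B' : basis_of M Y B -> basis_of M Y B' ->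
  #|` B| = #|` B'|.
Proof.
suff H C C' : basis_of M Y C -> basis_of M Y C' -> (#|` C| <= #|` C'|)%N.
  by move=> bB bB'; apply/eqP; rewrite eqn_leq !H.
move=> [sCY iC _] [sC'Y iC' mC']; rewrite leqNgt; apply/negP => ltC.
have [y] := indep_exchange iC' iC ltC.
rewrite inE => /andP[yC' yC] iyC'.
have E : (y |` C')%fset = C'.
  apply: mC' => //; first exact: fsubsetUr.
  by rewrite fsubUset fsub1set (fsubsetP sCY).
by move: yC'; rewrite -E !inE eqxx.
Qed.

Section Deletion.
Variables (M : matroid) (X : {fset K}).

Let E := (ground M `\` X)%fset.
Let I := [fset J in indep M | (J `<=` E)%fset]%fset.

Fact deletion_sub J : J \in I -> (J `<=` E)%fset.
Proof. by rewrite !inE => /andP[]. Qed.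

Fact deletion0 : fset0 \in I.
Proof. by rewrite !inE indep0 fsub0set. Qed.

Fact deletionS J L : (J `<=` L)%fset -> L \in I -> J \in I.
Proof.
rewrite !inE => sJL /andP[iL sLE].
by rewrite (indepS sJL iL) (fsubset_trans sJL sLE).
Qed.

Fact deletion_exchange J L : J \in I -> L \in I -> #|` J| < #|` L| ->
  exists2 y, y \in (L `\` J)%fset & (y |` J)%fset \in I.
Proof.
rewrite !inE => /andP[iJ sJE] /andP[iL sLE] ltJL.
have [y yLJ iyJ] := indep_exchange iJ iL ltJL; exists y => //.
move: yLJ; rewrite !inE iyJ fsubUset fsub1set sJE andbT => /andP[_ yL].
exact: (fsubsetP sLE).
Qed.

Definition deletion : matroid :=
  Matroid deletion_sub deletion0 deletionS deletion_exchange.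

End Deletion.

Section Contraction.
Variables (M : matroid) (Y : {fset K}).

Let E := (ground M `\` Y)%fset.
Let I := [fset J in fpowerset E |
  `[< exists2 B, basis_of M Y B & (J `|` B)%fset \in indep M >] ]%fset.

Let IP J : reflect ((J `<=` E)%fset /\
  exists2 B, basis_of M Y B & (J `|` B)%fset \in indep M) (J \in I).
Proof.
rewrite !inE fpowersetE; apply: (iffP andP) => -[? ?]; split=> //;
  exact/asboolP.
Qed.

Fact contraction_sub J : J \in I -> (J `<=` E)%fset.
Proof. by move=> /IP[]. Qed.

Fact contraction0 : fset0 \in I.
Proof.
apply/IP; rewrite fsub0set; split=> //.
have [B bB] := exists_basis_of M Y; exists B => //.
by rewrite fset0U; case: bB.
Qed.

Fact contractionS J L : (J `<=` L)%fset -> L \in I -> J \in I.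
Proof.
move=> sJL /IP[sLE [B bB iLB]]; apply/IP; split.
  exact: fsubset_trans sJL sLE.
by exists B => //; apply: indepS iLB; apply: fsetSU.
Qed.

Fact contraction_exchange J L : J \in I -> L \in I -> #|` J| < #|` L| ->
  exists2 y, y \in (L `\` J)%fset & (y |` J)%fset \in I.
Proof.
move=> /IP[sJE [B bB iJB]] /IP[sLE [B' bB' iLB']] ltJL.
have dis (H C : {fset K}) : (H `<=` E)%fset -> basis_of M Y C ->
    #|` (H `|` C)%fset| = (#|` H| + #|` C|)%N.
  move=> sHE [sCY _ _]; rewrite cardfsU; suff -> : (H `&` C = fset0)%fset.
    by rewrite cardfs0 subn0.
  apply/fsetP => x; rewrite !inE; apply/negP => /andP[xH xC].
  by move/(fsubsetP sHE): xH; rewrite inE (fsubsetP sCY _ xC).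
have ltU : #|` (J `|` B)%fset| < #|` (L `|` B')%fset|.
  by rewrite !dis // (card_basis_of bB bB') ltn_add2r.
have [y] := indep_exchange iJB iLB' ltU.
rewrite !inE negb_or => /andP[/andP[yJ yB] yLB'] iy.
case/orP: yLB' => [yL|yB'].
  exists y; first by rewrite inE yJ.
  apply/IP; split; last by exists B => //; rewrite -fsetUA.
  by rewrite fsubUset fsub1set sJE andbT (fsubsetP sLE).
case: bB bB' => sBY iB mB [sB'Y _ _].
have eB : (y |` B)%fset = B.
  apply: mB; first exact: fsubsetUr.
    by rewrite fsubUset fsub1set (fsubsetP sB'Y).
  by apply: indepS iy; apply: fsetUS; apply: fsubsetUr.
by move: yB; rewrite -eB !inE eqxx.
Qed.

Definition contraction : matroid :=
  Matroid contraction_sub contraction0 contractionS contraction_exchange.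

End Contraction.

Definition minor (N M : matroid) : Prop :=
  exists X Y : {fset K}, [/\ (X `<=` ground M)%fset,
    (Y `<=` ground M `\` X)%fset & N = contraction (deletion M X) Y].

End Matroid.

Section Gammoid.
Variable K : choiceType.

Record digraph := Digraph {
  vertices : {fset K};
  arcs : {fset K * K};
  arcs_sub : forall a, a \in arcs -> (a.1 \in vertices) && (a.2 \in vertices)
}.

Definition is_path (D : digraph) (p : seq K) : bool :=
  [&& p != [::], uniq p, all [in vertices D] p &
      sorted (fun u v => (u, v) \in arcs D) p].

Definition routing (D : digraph) (X Y : {fset K}) (R : {fset seq K}) : Prop :=
  [/\ forall p, p \in R -> is_path D p,
      forall x, x \in X -> exists2 p, p \in R & ohead p = Some x,
      forall p, p \in R -> exists2 y, y \in Y & ohead (rev p) = Some y &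
      forall p q, p \in R -> q \in R -> p != q ->
        forall v, ~~ ((v \in p) && (v \in q))].

(* M = Gamma(D, T, E) *)
Definition is_Gamma (M : matroid K) (D : digraph) (T E : {fset K}) : Prop :=
  ground M = E /\
  forall X, X \in indep M <-> (X `<=` E)%fset /\ exists R, routing D X T R.

Definition gammoid (M : matroid K) : Prop :=
  exists (D : digraph) (T E : {fset K}),
    [/\ (T `<=` vertices D)%fset, (E `<=` vertices D)%fset & is_Gamma M D T E].

Definition strict_gammoid (M : matroid K) : Prop :=
  exists (D : digraph) (T : {fset K}),
    (T `<=` vertices D)%fset /\ is_Gamma M D T (vertices D).

End Gammoid.

Definition equivalence_on {U : Type} (S : set U) (R : set (U * U)) : Prop :=
  [/\ R `<=` S `*` S,
      forall x, S x -> R (x, x),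
      forall x y, R (x, y) -> R (y, x) &
      forall x y z, R (x, y) -> R (y, z) -> R (x, z)].

Section Tableau.
Variable K : choiceType.

(* The data of a tableau; the requirement on [tab_eqv] is [is_tableau]. *)
Record tableau := Tableau {
  goal : matroid K;
  tab_gammoids : set (matroid K);
  tab_nonstrict : set (matroid K);
  tab_excluded : set (matroid K);
  tab_eqv : set (matroid K * matroid K)
}.

Definition tab_family (T : tableau) : set (matroid K) :=
  [set N | minor N (goal T)] `|` tab_gammoids T `|` tab_nonstrict T
    `|` tab_excluded T.

Definition is_tableau (T : tableau) : Prop :=
  equivalence_on (tab_family T) (tab_eqv T).

Definition tab_class (T : tableau) (M : matroid K) : set (matroid K) :=
  [set N | tab_eqv T (M, N)].

Definition valid (T : tableau) : Prop :=
  [/\ forall M, tab_gammoids T M -> gammoid M,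
      forall M, tab_nonstrict T M -> ~ strict_gammoid M,
      forall M, tab_excluded T M -> ~ gammoid M &
      forall M, tab_family T M ->
        (forall N, tab_class T M N -> gammoid N) \/
        (forall N, tab_class T M N -> ~ gammoid N)].

Definition generated_eqv (n : nat) (T : 'I_n.+1 -> tableau) :
    set (matroid K * matroid K) :=
  smallest (equivalence_on (\bigcup_i tab_family (T i)))
           (\bigcup_i tab_eqv (T i)).

(* The tableaux T_1, ..., T_n with n >= 1 are indexed by 'I_n.+1, so that
   [T ord0] is the first one. *)
Definition joint_tableau (n : nat) (T : 'I_n.+1 -> tableau) : tableau :=
  let G := goal (T ord0) in
  let gs := \bigcup_i tab_gammoids (T i) in
  let ms := \bigcup_i tab_nonstrict (T i) in
  let xs := \bigcup_i tab_excluded (T i) in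
  let F := [set N | minor N G] `|` gs `|` ms `|` xs in
  Tableau G gs ms xs (generated_eqv T `&` (F `*` F)).

End Tableau.

(* Main.v *)
(** The pairs of matroids on which "is a gammoid" takes the same value form an
    equivalence relation, and validity of the T_i says that it contains every
    equivalence of a T_i; hence it contains the one that they generate. *)

Require Import Defs.
From mathcomp Require Import all_boot finmap.
From mathcomp Require Import boolp classical_sets functions cardinality.

Local Open Scope classical_set_scope.

(** With [P] the gammoids, this relation is the competitor to which minimality of the generated
    equivalence is applied; membership in [S] keeps it on the underlying family. *)
Lemma equivalence_on_iff {U : Type} (S P : set U) :
  equivalence_on S [set xy | (S xy.1 /\ S xy.2) /\ (P xy.1 <-> P xy.2)].
Proof.
split=> [[x y] [] //|x Sx //|x y /= [[Sx Sy] Pxy]|x y z /=].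
  by split; last exact: iff_sym.
by move=> [[Sx _] Pxy] [[_ Sz] Pyz]; split; last exact: iff_trans Pyz.
Qed.

(** Reflexivity, symmetry and transitivity pass to intersections. *)
Lemma equivalence_on_smallest {U : Type} (S : set U) (G : set (U * U)) :
  G `<=` S `*` S -> equivalence_on S (smallest (equivalence_on S) G).
Proof.
move=> GS; split=> [xy|x Sx R [[_ + _ _] _]|x y xy R RG|x y z xy yz R RG].
(* The full relation on [S] is one of the intersected relations, by [GS], and bounds the
   intersection. *)
- move=> /(_ (S `*` S)); apply; split=> //; split=> // [x y []|x y z [Sx _] [_ Sz]] //.
- exact.
- by have [[_ _ + _] _] := RG; apply; exact: xy.
- by have [[_ _ _ tr] _] := RG; apply: tr (xy _ RG) (yz _ RG).
Qed.

Lemma equivalence_onI {U : Type} (S F : set U) (R : set (U * U)) :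
  F `<=` S -> equivalence_on S R -> equivalence_on F (R `&` (F `*` F)).
Proof.
move=> FS [_ Rr Rs Rt]; split=> [xy []//|x Fx|x y [xy []]|x y z [xy [Fx _]] [yz [_ Fz]]].
- by split=> //; apply/Rr/FS.
- by split=> //; exact: Rs.
- by split=> //; exact: Rt yz.
Qed.

Section JointTableau.
Variables (K : choiceType) (n : nat) (T : 'I_n.+1 -> tableau K).

(** The inclusion can be strict, since minors of the goals other than that of [T ord0] may be lost;
    hence the restriction in the joint tableau. *)
Lemma tab_family_joint :
  tab_family (joint_tableau T) `<=` \bigcup_i tab_family (T i).
Proof.
move=> M [[[mM|[i _ iM]]|[i _ iM]]|[i _ iM]].
- by exists ord0 => //; left; left; left.
- by exists i => //; left; left; right.
- by exists i => //; left; right.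
- by exists i => //; right.
Qed.

Hypothesis tabT : forall i, is_tableau (T i).

Lemma tab_eqv_sub_bigcup_family :
  \bigcup_i tab_eqv (T i) `<=`
  (\bigcup_i tab_family (T i)) `*` (\bigcup_i tab_family (T i)).
Proof.
move=> xy [i _ ixy]; have [sub _ _ _] := tabT i; have [Fx Fy] := sub _ ixy.
by split; exists i.
Qed.

Lemma is_tableau_joint : is_tableau (joint_tableau T).
Proof.
apply: equivalence_onI; first exact: tab_family_joint.
exact/equivalence_on_smallest/tab_eqv_sub_bigcup_family.
Qed.

Hypothesis validT : forall i, valid (T i).

Lemma tab_eqv_gammoid i M N : tab_eqv (T i) (M, N) -> gammoid M <-> gammoid N.
Proof.
move=> MN; have [sub rfl _ _] := tabT i; have [FM _] := sub _ MN.
(* The class of [M] contains both [N] and, by reflexivity, [M] itself, so either alternative settles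
   both. *)
have [_ _ _ /(_ M FM) [gam|ngam]] := validT i.
  by split=> _; apply: gam => //; exact: rfl.
by split=> [/(ngam M (rfl _ FM))|/(ngam N MN)].
Qed.

(** Minimality replaces an induction along chains of equivalences taken from different tableaux. *)
Lemma generated_eqv_gammoid M N :
  generated_eqv T (M, N) -> gammoid M <-> gammoid N.
Proof.
pose S := \bigcup_i tab_family (T i).
move=> /(_ [set xy | (S xy.1 /\ S xy.2) /\ (gammoid xy.1 <-> gammoid xy.2)]).
case=> //; split; first exact: equivalence_on_iff.
move=> [x y] xy; split; first exact: tab_eqv_sub_bigcup_family xy.
by have [i _ /tab_eqv_gammoid] := xy.
Qed.

Lemma valid_joint : valid (joint_tableau T).
Proof.
split=> [M [i _]|M [i _]|M [i _]|M _].
- by have [+ _ _ _] := validT i; exact.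
- by have [_ + _ _] := validT i; exact.
- by have [_ _ + _] := validT i; exact.
(* The status of [M] selects the alternative and is carried to its whole class. *)
- have [gM|ngM] := pselect (gammoid M); [left|right];
    by move=> N [/generated_eqv_gammoid MN _]; rewrite -MN.
Qed.

End JointTableau.

Theorem lemma3p2 (K : choiceType) (K_infinite : infinite_set [set: K]%classic)
    (n : nat) (T : 'I_n.+1 -> tableau K) :
  (forall i, is_tableau (T i)) ->
  (forall i, valid (T i)) ->
  is_tableau (joint_tableau T) /\ valid (joint_tableau T).
Proof.
by move=> tabT validT; split; [exact: is_tableau_joint|exact: valid_joint].
Qed.
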